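(* The following conditions are equivalent: (1) For every (associative, unital) $UJ$-ring $R$ whose Jacobson radical $J(R)$ is nil, the polynomial ring $R[x]$ is also a $UJ$-ring. (2) For every nil $\mathbb{F}_2$-algebra $A$, $J(A[x])=A[x]$. (3) For every nil $\mathbb{F}_2$-algebra $A$ and every $n\geq 1$, the matrix algebra $M_n(A)$ is nil. (4) Köthe's problem has a positive solution in the class of $\mathbb{F}_2$-algebras, i.e. every (associative, not necessarily unital) $\mathbb{F}_2$-algebra with no nonzero nil two-sided ideals has no nonzero nil one-sided ideals.
   Context: For a unital associative ring $R$, $U(R)$ is its group of units and $J(R)$ its Jacobson radical; $R$ is a $UJ$-ring if $U(R)=1+J(R)$. $\mathbb{F}_2$ is the field with two elements. Algebras are associative; a nil algebra is one in which every element is nilpotent (so it is without unity unless it is zero). An ideal (one-sided or two-sided) is nil if all its elements are nilpotent. For a ring $A$ without unity, $J(A)$ denotes the largest two-sided ideal of $A$ consisting of quasi-regular elements, where $a$ is quasi-regular if it is invertible in the monoid $(A,\circ)$, $a\circ b=a+b-ab$. $A[x]$ is the polynomial ring in one variable $x$ commuting with coefficients from $A$. *)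

(* Defs.v *)
From HB Require Import structures.
From mathcomp Require Import all_boot all_algebra.
From mathcomp Require Import finmap.
From mathcomp Require Import boolp classical_sets.
From mathcomp Require Import monalg.

Set Implicit Arguments.
Unset Strict Implicit.
Unset Printing Implicit Defensive.

Import GRing.Theory.
Local Open Scope classical_set_scope.
Local Open Scope ring_scope.

(* Associative rings and algebras that need not have a unity: MathComp's ring
   structures are all unital. *)
HB.mixin Record Zmodule_isNuRing A of GRing.Zmodule A := {
  numul : A -> A -> A;
  numulA : associative numul;
  numulDl : left_distributive numul +%R;
  numulDr : right_distributive numul +%R
}.

#[short(type="nuRingType")]
HB.structure Definition NuRing := { A of GRing.Zmodule A & Zmodule_isNuRing A }.

HB.mixin Record NuRing_Lmodule_isNuAlgebra (F : fieldType) A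
    of NuRing A & GRing.Lmodule F A := {
  nuscaleAl : forall (k : F) (a b : A), k *: numul a b = numul (k *: a) b;
  nuscaleAr : forall (k : F) (a b : A), k *: numul a b = numul a (k *: b)
}.

#[short(type="nuAlgType")]
HB.structure Definition NuAlgebra (F : fieldType) :=
  { A of NuRing A & GRing.Lmodule F A & NuRing_Lmodule_isNuAlgebra F A }.

Infix "**" := numul (at level 40, left associativity) : ring_scope.

(* The multiplication is a parameter so that the same notions serve unital
   rings and rings without unity.  Ideals are ring ideals; in an algebra over
   'F_2 they are exactly the algebra ideals, since the scalars are 0 and 1. *)
Section Ideals.
Variables (A : zmodType) (mul : A -> A -> A).
Implicit Type I : set A.

Definition additive_subgroup I :=
  I 0 /\ forall x y, I x -> I y -> I (x - y).

Definition left_ideal I :=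
  additive_subgroup I /\ forall a x, I x -> I (mul a x).

Definition right_ideal I :=
  additive_subgroup I /\ forall a x, I x -> I (mul x a).

Definition two_sided_ideal I := left_ideal I /\ right_ideal I.

Definition maximal_left_ideal I :=
  [/\ left_ideal I, I <> setT &
      forall I', left_ideal I' -> I `<=` I' -> I' = I \/ I' = setT].

End Ideals.

(* [nzRingType] leaves out only the zero ring R, for which R and R[x] = 0 are
   both trivially UJ-rings. *)
Section Unital.
Variable R : nzRingType.

Definition units : set R := [set u | exists v, u * v = 1 /\ v * u = 1].

Definition jacobson : set R :=
  [set x | forall M, maximal_left_ideal *%R M -> M x].

Definition UJ_ring := units = [set 1 + j | j in jacobson].

Definition nilpotent : set R := [set x | exists n, x ^+ n = 0].

End Unital.

Arguments units : clear implicits.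
Arguments jacobson : clear implicits.
Arguments nilpotent : clear implicits.

Section NonUnital.
Variable A : nuRingType.

(* [nuexpS a n] is a ^ (n + 1); there is no zeroth power. *)
Definition nuexpS (a : A) n : A := iter n (numul a) a.

Definition nunilpotent : set A := [set a | exists n, nuexpS a n = 0].

Definition nil_nuring := forall a : A, nunilpotent a.

Definition circ (a b : A) : A := a + b - a ** b.

Definition quasi_regular : set A :=
  [set a | exists b, circ a b = 0 /\ circ b a = 0].

Definition quasi_regular_ideal (I : set A) :=
  two_sided_ideal numul I /\ I `<=` quasi_regular.

(* The union of all quasi-regular ideals; [nujacobson_ideal] shows that it is
   itself one, hence the largest. *)
Definition nujacobson : set A :=
  [set x | exists2 I, quasi_regular_ideal I & I x].

End NonUnital.

Arguments nunilpotent : clear implicits.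
Arguments quasi_regular : clear implicits.
Arguments nujacobson : clear implicits.

Definition kothe_property (A : nuRingType) :=
  (forall I, two_sided_ideal (@numul A) I -> I `<=` nunilpotent A ->
     I = [set 0]) ->
  (forall I, left_ideal (@numul A) I \/ right_ideal (@numul A) I ->
     I `<=` nunilpotent A -> I = [set 0]).

Section NuRingTheory.
Variable A : nuRingType.
Implicit Types a b c : A.

Lemma numull_additive a : zmod_morphism (numul^~ a).
Proof.
move=> x y; apply: (addIr (y ** a)).
by rewrite -numulDl !subrK.
Qed.

Lemma numulr_additive a : zmod_morphism (numul a).
Proof.
move=> x y; apply: (addIr (a ** y)).
by rewrite -numulDr !subrK.
Qed.

HB.instance Definition _ a :=
  GRing.isZmodMorphism.Build A A (numul a) (numulr_additive a).

Definition numulr a b := b ** a.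
HB.instance Definition _ a :=
  GRing.isZmodMorphism.Build A A (numulr a) (numull_additive a).

Lemma nu0mul a : 0 ** a = 0. Proof. exact: (raddf0 (numulr a)). Qed.
Lemma numul0 a : a ** 0 = 0. Proof. exact: raddf0. Qed.
Lemma nuNmul a b : (- a) ** b = - (a ** b).
Proof. exact: (raddfN (numulr b)). Qed.
Lemma numulN a b : a ** (- b) = - (a ** b). Proof. exact: raddfN. Qed.
Lemma nusuml I (r : seq I) P (F : I -> A) a :
  (\sum_(i <- r | P i) F i) ** a = \sum_(i <- r | P i) F i ** a.
Proof. exact: (raddf_sum (numulr a)). Qed.
Lemma nusumr I (r : seq I) P (F : I -> A) a :
  a ** (\sum_(i <- r | P i) F i) = \sum_(i <- r | P i) a ** F i.
Proof. exact: raddf_sum. Qed.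

End NuRingTheory.

(* M_n(A) *)
Section Matrix.
Variables (A : nuRingType) (n : nat).
Implicit Types M N P : 'M[A]_n.

Definition nu_mulmx M N : 'M[A]_n := \matrix_(i, j) \sum_k M i k ** N k j.

Lemma nu_mulmxA : associative nu_mulmx.
Proof.
move=> M N P; apply/matrixP => i j; rewrite !mxE.
under eq_bigr do rewrite mxE nusumr.
rewrite exchange_big; apply: eq_bigr => k _ /=.
by rewrite mxE nusuml; apply: eq_bigr => l _; rewrite numulA.
Qed.

Lemma nu_mulmxDl : left_distributive nu_mulmx +%R.
Proof.
move=> M N P; apply/matrixP => i j; rewrite !mxE -big_split.
by apply: eq_bigr => k _; rewrite mxE numulDl.
Qed.

Lemma nu_mulmxDr : right_distributive nu_mulmx +%R.
Proof.
move=> M N P; apply/matrixP => i j; rewrite !mxE -big_split.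
by apply: eq_bigr => k _; rewrite mxE numulDr.
Qed.

HB.instance Definition _ := Zmodule_isNuRing.Build 'M[A]_n
  nu_mulmxA nu_mulmxDl nu_mulmxDr.

End Matrix.

(* A[x]: the finitely supported functions from the exponents to A, with
   << a *g i >> the monomial a x^i and p@_i the coefficient of x^i. *)
Definition nupoly (A : nuRingType) := {malg A[nat]}.

HB.instance Definition _ (A : nuRingType) :=
  GRing.Zmodule.copy (nupoly A) {malg A[nat]}.

Section Polynomial.
Variable A : nuRingType.
Implicit Types p q r : nupoly A.

Definition nupoly_mul p q : nupoly A :=
  \sum_(i <- msupp p) \sum_(j <- msupp q) << p@_i ** q@_j *g (i + j)%N >>.

Lemma coef_nupoly_mul p q n :
  (nupoly_mul p q)@_n = \sum_(i < n.+1) p@_(val i) ** q@_(n - i)%N.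
Proof.
have innerE i : (\sum_(j <- msupp q) << p@_i ** q@_j *g (i + j)%N >>)@_n
    = if (i < n.+1)%N then p@_i ** q@_(n - i)%N else 0.
  rewrite raddf_sum /=; under eq_bigr do rewrite mcoeffU.
  case: ltnP => [le_in|lt_ni].
    rewrite ltnS in le_in.
    have eqE j : (i + j == n)%N = (j == n - i)%N.
      by rewrite -{1}(subnKC le_in) eqn_add2l.
    under eq_bigr do rewrite eqE.
    have [qni|qni] := boolP ((n - i)%N \in msupp q).
      rewrite (bigD1_seq _ qni) ?fset_uniq //= eqxx mulr1n.
      by rewrite big1 ?addr0 // => j /negPf->.
    rewrite (mcoeff_outdom qni) numul0 big_seq big1 // => j qj.
    by case: eqP => // ej; rewrite -ej qj in qni.
  rewrite big1 // => j _; case: eqP; rewrite ?mulr0n // => ijn.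
  by rewrite -ijn ltnNge leq_addr in lt_ni.
rewrite /nupoly_mul raddf_sum /=; under eq_bigr do rewrite innerE.
rewrite -big_mkcond /= -[RHS](big_mkord xpredT (fun i => p@_i ** q@_(n - i)%N)).
rewrite [RHS](bigID (mem (msupp p))) /= [X in _ + X]big1 => [|i pi]; last first.
  by rewrite (mcoeff_outdom pi) nu0mul.
rewrite addr0 -big_filter -[RHS]big_filter; apply: perm_big; apply: uniq_perm.
- by rewrite filter_uniq ?fset_uniq.
- by rewrite filter_uniq ?iota_uniq.
by move=> i; rewrite !mem_filter mem_index_iota andbC.
Qed.

Lemma nupoly_mulDl : left_distributive nupoly_mul +%R.
Proof.
move=> p q r; apply/malgP => n; rewrite mcoeffD !coef_nupoly_mul -big_split.
by apply: eq_bigr => i _; rewrite mcoeffD numulDl.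
Qed.

Lemma nupoly_mulDr : right_distributive nupoly_mul +%R.
Proof.
move=> p q r; apply/malgP => n; rewrite mcoeffD !coef_nupoly_mul -big_split.
by apply: eq_bigr => i _; rewrite mcoeffD numulDr.
Qed.

Lemma coef_nupoly_mul_rev p q n :
  (nupoly_mul p q)@_n = \sum_(i < n.+1) p@_(n - i)%N ** q@_(val i).
Proof.
rewrite coef_nupoly_mul (reindex_inj rev_ord_inj) /=.
by apply: eq_bigr => i _; rewrite (sub_ordK i).
Qed.

Lemma nupoly_mulA : associative nupoly_mul.
Proof.
move=> p q r; apply/malgP => n; rewrite coef_nupoly_mul coef_nupoly_mul_rev.
pose coef3 i j := p@_i ** (q@_(n - i - j)%N ** r@_j).
transitivity (\sum_(i < n.+1) \sum_(j < n.+1 | (j <= n - i)%N) coef3 i j).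
  apply: eq_bigr => /= i _; rewrite coef_nupoly_mul_rev nusumr.
  by rewrite (big_ord_narrow_leq (leq_subr _ _)).
rewrite (exchange_big_dep predT) //=; apply: eq_bigr => j _.
transitivity (\sum_(i < n.+1 | (i <= n - j)%N) coef3 i j).
  apply: eq_bigl => i; rewrite -ltnS -(ltnS i) -!subSn ?leq_ord //.
  by rewrite -subn_gt0 -(subn_gt0 i) -!subnDA addnC.
rewrite (big_ord_narrow_leq (leq_subr _ _)) coef_nupoly_mul nusuml /=.
by apply: eq_bigr => i _; rewrite /coef3 -!subnDA addnC numulA.
Qed.

HB.instance Definition _ := Zmodule_isNuRing.Build (nupoly A)
  nupoly_mulA nupoly_mulDl nupoly_mulDr.

End Polynomial.

Section Jacobson.
Variable A : nuRingType.
Implicit Types (a b c : A) (I J : set A).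

Lemma circA : associative (@circ A).
Proof.
move=> a b c; rewrite /circ !(numulDr, numulDl) !(nuNmul, numulN) numulA.
rewrite !opprD !opprK -!addrA; congr (_ + (_ + _)).
rewrite [RHS]addrCA; congr (_ + _); rewrite [LHS]addrCA.
by congr (_ + _); rewrite addrCA.
Qed.

Lemma circ0a : left_id 0 (@circ A).
Proof. by move=> a; rewrite /circ nu0mul add0r subr0. Qed.

Lemma circa0 : right_id 0 (@circ A).
Proof. by move=> a; rewrite /circ numul0 addr0 subr0. Qed.

Lemma quasi_regular_circ a b :
  quasi_regular A a -> quasi_regular A b -> quasi_regular A (circ a b).
Proof.
move=> [a' [aa' a'a]] [b' [bb' b'b]]; exists (circ b' a'); split.
  by rewrite circA -(circA a) bb' circa0.
by rewrite circA -(circA b') a'a circa0.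
Qed.

Lemma quasi_regular_ideal_add I J :
  quasi_regular_ideal I -> quasi_regular_ideal J ->
  quasi_regular_ideal [set x + y | x in I & y in J].
Proof.
move=> [[[gI lI] [_ rI]] qI] [[[gJ lJ] [_ rJ]] qJ].
have gIJ : additive_subgroup [set x + y | x in I & y in J].
  split=> [|_ _ [x1 Ix1 [y1 Jy1 <-]] [x2 Ix2 [y2 Jy2 <-]]].
    by exists 0; [exact: gI.1 | exists 0; [exact: gJ.1 | exact: addr0]].
  exists (x1 - x2); first exact: gI.2.
  by exists (y1 - y2); [exact: gJ.2 | rewrite opprD addrACA].
split; first (split; split=> //).
- move=> a _ [x Ix [y Jy <-]]; exists (a ** x); first exact: lI.
  by exists (a ** y); [exact: lJ | rewrite numulDr].
- move=> a _ [x Ix [y Jy <-]]; exists (x ** a); first exact: rI.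
  by exists (y ** a); [exact: rJ | rewrite numulDl].
move=> _ [x Ix [y Jy <-]]; have [x' [xx' x'x]] := qI _ Ix.
have -> : x + y = circ x (y - x' ** y).
  have -> : y - x' ** y = circ x' (x + y).
    by rewrite -[LHS]add0r -x'x /circ numulDr opprD (addrA x' x) [LHS]addrACA.
  by rewrite circA xx' circ0a.
apply: quasi_regular_circ; first exact: qI.
by apply/qJ/gJ.2 => //; apply: lJ.
Qed.

Lemma nujacobson_ideal : quasi_regular_ideal (nujacobson A).
Proof.
have gN : additive_subgroup (nujacobson A).
  split=> [|x y [I qI Ix] [J qJ Jy]].
    exists [set 0]; last by [].
    split; last by move=> _ ->; exists 0; rewrite circ0a.
    have g0 : additive_subgroup [set 0 : A].
      by split=> // x y -> ->; exact: subr0.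
    by split; split=> // a _ ->; [exact: numul0 | exact: nu0mul].
  exists [set x + y | x in I & y in J]; first exact: quasi_regular_ideal_add.
  exists x => //; exists (- y) => //.
  by rewrite -[- y]add0r; have [[[[J0 JB] _] _] _] := qJ; exact: JB.
split; last by move=> x [I [_ qI] /qI].
split; split=> // a x [I qI Ix]; exists I => //.
  by have [[[_ lI] _] _] := qI; apply: lI.
by have [[_ [_ rI]] _] := qI; apply: rI.
Qed.

Lemma nujacobson_max I : quasi_regular_ideal I -> I `<=` nujacobson A.
Proof. by move=> qI x Ix; exists I. Qed.

End Jacobson.

(* Main.v *)
From HB Require Import structures.
Require Import Defs.
From mathcomp Require Import all_boot all_algebra.
From mathcomp Require Import finmap.
From mathcomp Require Import boolp classical_sets.
From mathcomp Require Import monalg.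

Set Implicit Arguments.
Unset Strict Implicit.
Unset Printing Implicit Defensive.

Import GRing.Theory.
Local Open Scope classical_set_scope.
Local Open Scope ring_scope.

(** The four conditions are linked in a circle, the last one being taken back to
the first through the other two.  Throughout, A is a nil algebra over the field
with two elements and A^# = F_2 + A is its unitization.

Radical polynomials from UJ-rings.  A^# is a UJ-ring with nil Jacobson radical
A, so condition (1) makes A^#[x] a UJ-ring.  A monomial a x^i with a in A is
nilpotent, so 1 + a x^i is a unit and a x^i lies in J(A^#[x]); hence so does
every element of A[x], and A[x] is quasi-regular ([UJ_poly_radical]).

Nil matrices from radical polynomials.  Quasi-regularity passes from A[x] to
M_n(A[x]), one column at a time.  If M is a matrix over A, the only possible
inverse of 1 - M x has coefficients the powers of M, and it has to be a
polynomial; so M is nilpotent ([quasi_regular_poly_nilpotent]).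

Koethe from nil matrices.  If L is a nil left ideal, an element of the ideal
L A^# is a product c d of a row c over L by a column d over A^#, and
(c d)^(k+1) = c (d c)^k d, where d c is a square matrix over the nil algebra L.
So L A^# is a nil two-sided ideal containing L; right ideals are similar
([nil_matrices_kothe]).

Nil matrices from Koethe.  A matrix over A is the sum of its columns, and the
matrices supported on one column form a nil left ideal.  By Koethe's property
for the quotient by the sum of all nil ideals, this left ideal consists of
elements of nil ideals ([kothe_nil_matrices]).

Radical polynomials from nil matrices.  To invert 1 - p, with
p = a_1 x + a_2 x^2 + ..., take the companion matrix C of p: the power series
inverse of 1 - p has as coefficients the upper left entries of the powers of C.
Modulo A, C is a nilpotent shift, so a power of C is a matrix over A and C is
nilpotent: the series is a polynomial ([nil_matrices_poly_radical]).

UJ-polynomials from radical polynomials.  Let R be a UJ-ring with J = J(R) nil.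
Then J contains 2 and every nilpotent element, so R/J is reduced and the units
of R[x] lie in 1 + J[x].  It remains to invert 1 - f for f in J[x].  This can
be done modulo 2 J[x], because J/2J is a nil F_2-algebra; and the remaining
error is nilpotent since 2 is ([polynomial_UJ]). *)

(** * Powers and quasi-regularity in rings without unity *)

Section NuPowers.
Variable A : nuRingType.
Implicit Types a b : A.

Lemma nuexpS_add a m n : nuexpS a m ** nuexpS a n = nuexpS a (m + n).+1.
Proof. by elim: m => //= m IHm; rewrite -numulA IHm. Qed.

Lemma nuexpSr a n : nuexpS a n.+1 = nuexpS a n ** a.
Proof. by rewrite (nuexpS_add a n 0) addn0. Qed.

Lemma nuexpSM a m n : nuexpS (nuexpS a m) n = nuexpS a (m + n * m.+1).
Proof.
elim: n => [|n IHn]; first by rewrite addn0.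
by rewrite [LHS]/= IHn nuexpS_add mulSn addSn !addnS.
Qed.

Lemma nunilpotent_nuexpS a n :
  nunilpotent A (nuexpS a n) -> nunilpotent A a.
Proof. by move=> [m]; rewrite nuexpSM; exists (n + m * n.+1)%N. Qed.

(** A monoid in which every element has a right inverse is a group; here the
    monoid is [circ]. *)
Lemma right_circ_quasi_regular :
  (forall a, exists b, circ a b = 0) -> forall a, quasi_regular A a.
Proof.
move=> rA a; have [b ab0] := rA a; have [c bc0] := rA b.
have ca : c = a by rewrite -[RHS]circa0 -bc0 circA ab0 circ0a.
by exists b; rewrite -{2}ca.
Qed.

(** The whole ring is an ideal, so no ideal needs to be exhibited to show
    that a ring is radical. *)
Lemma nujacobsonTP :
  nujacobson A = setT <-> forall a, quasi_regular A a.
Proof.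
split=> [JT a|qA].
  by have [_] := nujacobson_ideal A; apply; rewrite JT.
have qT : quasi_regular_ideal [set: A] by split=> // x _; exact: qA.
by apply/seteqP; split=> // a _; exact: nujacobson_max qT a I.
Qed.

End NuPowers.

Section AdditiveSubgroup.
Variables (A : zmodType) (I : set A).
Hypothesis gI : additive_subgroup I.

Lemma subgroup0 : I 0. Proof. exact: gI.1. Qed.

Lemma subgroupB x y : I x -> I y -> I (x - y). Proof. exact: gI.2. Qed.

Lemma subgroupN x : I x -> I (- x).
Proof. by rewrite -[- x]sub0r; apply/subgroupB/subgroup0. Qed.

Lemma subgroupD x y : I x -> I y -> I (x + y).
Proof. by move=> Ix Iy; rewrite -[y]opprK; apply/subgroupB/subgroupN. Qed.

Lemma subgroup_sum T (r : seq T) (P : pred T) (F : T -> A) :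
  (forall i, P i -> I (F i)) -> I (\sum_(i <- r | P i) F i).
Proof.
move=> IF; elim/big_rec: _ => [|i x /IF Fi Ix]; first exact: subgroup0.
exact: subgroupD.
Qed.

End AdditiveSubgroup.

(** * Subquotients that are algebras over the two-element field *)

Lemma F2_cases (k : 'F_2) : k = 0 \/ k = 1.
Proof. by case: k => [[|[|//]] lt_k2]; [left|right]; apply: val_inj. Qed.

(** The map [f] presents [B] as S/I; it is defined on all of [A] so that it
    can be applied to entries and coefficients. The ambient product is a
    parameter, so that unital rings and rings without unity can both be cut
    down this way. *)
Definition is_subquotient (A : zmodType) (mul : A -> A -> A) (S I : set A)
    (B : nuRingType) (f : A -> B) :=
  [/\ forall x y, S x -> S y -> f (x - y) = f x - f y,
      forall x y, S x -> S y -> f (mul x y) = f x ** f y,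
      forall b, exists2 x, S x & f x = b
    & forall x, S x -> (f x = 0 <-> I x)].

Section Subquotient.
Variables (A : zmodType) (mul : A -> A -> A) (S I : set A).
Hypotheses (mulA : associative mul) (mulDl : left_distributive mul +%R)
  (mulDr : right_distributive mul +%R).
Hypotheses (gS : additive_subgroup S)
  (mulS : forall x y, S x -> S y -> S (mul x y)).
Hypotheses (gI : additive_subgroup I)
  (mulSI : forall s x, S s -> I x -> I (mul s x))
  (mulIS : forall s x, S s -> I x -> I (mul x s)).
Hypothesis SI2 : forall x, S x -> I (x + x).

(** A chosen element of the class of [x] modulo [I], and of the class of [0]
    when [x] is outside of [S], so that the choice is a total function. *)
Definition subquot_repr (x : A) : A :=
  let y := if `[< S x >] then x else 0 in xget 0 [set z | S z /\ I (y - z)].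

Definition subquot := {x : A | `[< exists y, x = subquot_repr y >]}.
HB.instance Definition _ :=
  Choice.copy subquot {x : A | `[< exists y, x = subquot_repr y >]}.

Definition subquot_pi x : subquot :=
  exist _ (subquot_repr x) (asboolT (ex_intro _ x erefl)).

Let pi := subquot_pi.

Let repr_spec x : S x -> S (sval (pi x)) /\ I (x - sval (pi x)).
Proof.
move=> Sx; rewrite /pi/= /subquot_repr asboolT //.
case: xgetP => [y _ //|/(_ x) []]; split=> //; rewrite subrr.
exact: subgroup0.
Qed.

Let surj t : exists2 x, S x & t = pi x.
Proof.
have /asboolP[y ty] := svalP t.
have ty0 : ~ S y -> sval t = subquot_repr 0.
  move=> nSy; rewrite ty /subquot_repr (asboolF nSy).
  by rewrite (asboolT (subgroup0 gS)).
have [Sy|/ty0 t0] := pselect (S y); first by exists y => //; apply: val_inj.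
by exists 0; [exact: subgroup0|exact: val_inj].
Qed.

Let sval_S (t : subquot) : S (sval t).
Proof. by have [x /repr_spec[Sx _] ->] := surj t. Qed.

Let eq_pi x y : S x -> S y -> I (x - y) -> pi x = pi y.
Proof.
move=> Sx Sy Ixy; apply: val_inj; rewrite /= /subquot_repr !asboolT //.
congr xget; apply/seteqP; split=> z /= [Sz Iz]; split=> //.
  rewrite -(addrNK x y) -addrA; apply: subgroupD => //.
  by rewrite -opprB; apply: subgroupN.
by rewrite -(addrNK y x) -addrA; apply: subgroupD.
Qed.

Let pi_eq x y : S x -> S y -> pi x = pi y -> I (x - y).
Proof.
move=> Sx Sy exy; have [_ Ix] := repr_spec Sx; have [_ Iy] := repr_spec Sy.
rewrite -(addrNK (sval (pi x)) x) -addrA {2}exy; apply: subgroupD => //.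
by rewrite -opprB; apply: subgroupN.
Qed.

Let add (t u : subquot) := pi (sval t + sval u).
Let opp (t : subquot) := pi (- sval t).
Let smul (t u : subquot) := pi (mul (sval t) (sval u)).
Let scale (k : 'F_2) (t : subquot) := if k == 0 then pi 0 else t.

Let mul0 x : mul x 0 = 0.
Proof. by apply: (addrI (mul x 0)); rewrite -mulDr !addr0. Qed.
Let mul0r x : mul 0 x = 0.
Proof. by apply: (addrI (mul 0 x)); rewrite -mulDl !addr0. Qed.
Let mulB x y z : mul x (y - z) = mul x y - mul x z.
Proof. by apply: (addIr (mul x z)); rewrite -mulDr !subrK. Qed.
Let mulBl x y z : mul (y - z) x = mul y x - mul z x.
Proof. by apply: (addIr (mul z x)); rewrite -mulDl !subrK. Qed.

Let piD x y : S x -> S y -> add (pi x) (pi y) = pi (x + y).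
Proof.
move=> Sx Sy; have [Sx' Ix] := repr_spec Sx; have [Sy' Iy] := repr_spec Sy.
apply/esym/eq_pi; try exact: subgroupD.
by rewrite opprD addrACA; apply: subgroupD.
Qed.

Let piN x : S x -> opp (pi x) = pi (- x).
Proof.
move=> Sx; have [Sx' Ix] := repr_spec Sx.
by apply/esym/eq_pi; rewrite -?opprD; apply: subgroupN.
Qed.

Let piM x y : S x -> S y -> smul (pi x) (pi y) = pi (mul x y).
Proof.
move=> Sx Sy; have [Sx' Ix] := repr_spec Sx; have [Sy' Iy] := repr_spec Sy.
apply/esym/eq_pi; try exact: mulS.
rewrite -(subrK (mul x (sval (pi y))) (mul x y)) -addrA -mulB -mulBl.
by apply: subgroupD => //; [exact: mulSI|exact: mulIS].
Qed.

Let addA : associative add.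
Proof.
move=> t u v; have [x Sx ->] := surj t; have [y Sy ->] := surj u.
have [z Sz ->] := surj v.
by rewrite !piD ?addrA //; apply: subgroupD.
Qed.

Let addC : commutative add.
Proof. by move=> t u; rewrite /add addrC. Qed.

Let add0 : left_id (pi 0) add.
Proof.
move=> t; have [x Sx ->] := surj t; rewrite piD ?add0r //.
exact: subgroup0.
Qed.

Let addN : left_inverse (pi 0) opp add.
Proof.
move=> t; have [x Sx ->] := surj t.
by rewrite piN // piD ?addNr //; exact: subgroupN.
Qed.

HB.instance Definition _ := GRing.isZmodule.Build subquot addA addC add0 addN.

Let smulA : associative smul.
Proof.
move=> t u v; have [x Sx ->] := surj t; have [y Sy ->] := surj u.
have [z Sz ->] := surj v.
by rewrite !piM ?mulA //; apply: mulS.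
Qed.

Let smulDl : left_distributive smul add.
Proof.
move=> t u v; have [x Sx ->] := surj t; have [y Sy ->] := surj u.
have [z Sz ->] := surj v.
by rewrite piD // !piM ?mulDl ?piD //; try apply: subgroupD; try apply: mulS.
Qed.

Let smulDr : right_distributive smul add.
Proof.
move=> t u v; have [x Sx ->] := surj t; have [y Sy ->] := surj u.
have [z Sz ->] := surj v.
by rewrite piD // !piM ?mulDr ?piD //; try apply: subgroupD; try apply: mulS.
Qed.

HB.instance Definition _ :=
  Zmodule_isNuRing.Build subquot smulA smulDl smulDr.

Let subquot2 t : add t t = pi 0.
Proof.
have [x Sx ->] := surj t; rewrite piD //; apply: eq_pi.
- exact: subgroupD.
- exact: subgroup0.
- by rewrite subr0; apply: SI2.
Qed.

Let scaleA a b t : scale a (scale b t) = scale (a * b) t.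
Proof. by case: (F2_cases a) => ->; case: (F2_cases b) => ->. Qed.

Let scale1 : left_id 1 scale.
Proof. by []. Qed.

Let scaleDr : right_distributive scale add.
Proof. by move=> a t u; case: (F2_cases a) => ->; rewrite /scale /= ?add0. Qed.

Let scaleDl t : {morph scale^~ t : a b / a + b >-> add a b}.
Proof.
by move=> a b; case: (F2_cases a) => ->; case: (F2_cases b) => ->;
  rewrite /scale/= ?add0 1?addC ?add0 // subquot2.
Qed.

HB.instance Definition _ :=
  GRing.Zmodule_isLmodule.Build 'F_2 subquot scaleA scale1 scaleDr scaleDl.

Let scaleAl (k : 'F_2) t u : scale k (smul t u) = smul (scale k t) u.
Proof.
case: (F2_cases k) => ->; rewrite /scale //=; have [y Sy ->] := surj u.
by rewrite piM ?mul0r //; apply: subgroup0.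
Qed.

Let scaleAr (k : 'F_2) t u : scale k (smul t u) = smul t (scale k u).
Proof.
case: (F2_cases k) => ->; rewrite /scale //=; have [y Sy ->] := surj t.
by rewrite piM ?mul0 //; apply: subgroup0.
Qed.

HB.instance Definition _ :=
  NuRing_Lmodule_isNuAlgebra.Build 'F_2 subquot scaleAl scaleAr.

(** Conditions quantified over types of algebras become applicable to
    subsets: a subring [S] (with [I = 0]), a quotient (with [S] the whole
    ring), or J/2J. As [S + S] vanishes modulo [I], the quotient is a vector
    space over the two-element field, whatever the ambient ring is. *)
Lemma subquotient_exists :
  exists (B : nuAlgType 'F_2) (f : A -> B), is_subquotient mul S I f.
Proof.
exists subquot, pi; split=> [x y Sx Sy|x y Sx Sy|t|x Sx].
- suff : pi (x - y) = add (pi x) (opp (pi y)) by [].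
  by rewrite piN // piD //; apply: subgroupN.
- exact/esym/piM.
- by have [x Sx ->] := surj t; exists x.
split=> [/(pi_eq Sx (subgroup0 gS))|Ix]; first by rewrite subr0.
by apply: eq_pi; rewrite ?subr0 //; exact: subgroup0.
Qed.

End Subquotient.

Section SubquotientTheory.
Variables (A : zmodType) (mul : A -> A -> A) (S I : set A).
Variables (B : nuRingType) (f : A -> B).
Hypotheses (gS : additive_subgroup S) (fP : is_subquotient mul S I f).

Lemma subquotientB x y : S x -> S y -> f (x - y) = f x - f y.
Proof. by case: fP => fB _ _ _; apply: fB. Qed.

Lemma subquotientM x y : S x -> S y -> f (mul x y) = f x ** f y.
Proof. by case: fP => _ fM _ _; apply: fM. Qed.

Lemma subquotient_surj b : exists2 x, S x & f x = b.
Proof. by case: fP => _ _ fS _; apply: fS. Qed.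

Lemma subquotient_eq0 x : S x -> f x = 0 <-> I x.
Proof. by case: fP => _ _ _ f0; apply: f0. Qed.

Lemma subquotient0 : f 0 = 0.
Proof.
have S0 := subgroup0 gS.
by rewrite -[in LHS](subrr 0) subquotientB // subrr.
Qed.

Lemma subquotientN x : S x -> f (- x) = - f x.
Proof.
by move=> Sx; rewrite -sub0r subquotientB ?subquotient0 ?sub0r //; case: gS.
Qed.

Lemma subquotientD x y : S x -> S y -> f (x + y) = f x + f y.
Proof.
move=> Sx Sy; have SNy := subgroupN gS Sy.
by rewrite -[y in LHS]opprK subquotientB // subquotientN // opprK.
Qed.

Lemma subquotient_sum T (r : seq T) (P : pred T) (F : T -> A) :
  (forall i, S (F i)) ->
  f (\sum_(i <- r | P i) F i) = \sum_(i <- r | P i) f (F i).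
Proof.
move=> SF; elim: r => [|i r IHr]; first by rewrite !big_nil subquotient0.
rewrite !big_cons; case: ifP => // _.
by rewrite subquotientD ?IHr //; apply: subgroup_sum.
Qed.

End SubquotientTheory.

(** * Unitization *)

Section Unitization.
Variables (F : fieldType) (A : nuAlgType F).

Definition unitization := (F * A)%type.
HB.instance Definition _ := GRing.Zmodule.copy unitization (F * A)%type.

Implicit Types x y z : unitization.

Let mul x y : unitization :=
  (x.1 * y.1, x.1 *: y.2 + y.1 *: x.2 + x.2 ** y.2).

Let mulA : associative mul.
Proof.
move=> [k a] [l b] [m c]; congr pair; rewrite /= ?mulrA //.
rewrite !(scalerDr, numulDr, numulDl, scalerA) !(nuscaleAl, nuscaleAr).
rewrite -!nuscaleAl -!nuscaleAr numulA (mulrC l m) (mulrC k m) !addrA.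
congr (_ + _); rewrite -!addrA; do 2 congr (_ + _).
by rewrite addrCA; congr (_ + _); rewrite addrA addrC.
Qed.

Let mulDl : left_distributive mul +%R.
Proof.
move=> [k a] [l b] [m c]; congr pair; rewrite /= ?mulrDl //.
by rewrite scalerDl scalerDr numulDl addrACA addrACA (addrACA (k *: c)) addrACA.
Qed.

Let mulDr : right_distributive mul +%R.
Proof.
move=> [k a] [l b] [m c]; congr pair; rewrite /= ?mulrDr //.
by rewrite scalerDl scalerDr numulDr addrACA addrACA (addrACA (k *: b)) addrACA.
Qed.

Let mul1 : left_id ((1, 0) : unitization) mul.
Proof.
by case=> k a; rewrite /mul /= mul1r scale1r scaler0 nu0mul !addr0.
Qed.

Let mulx1 : right_id ((1, 0) : unitization) mul.
Proof.
by case=> k a; rewrite /mul /= mulr1 scale1r scaler0 numul0 add0r addr0.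
Qed.

Let neq10 : (1, 0) != 0 :> unitization.
Proof. by rewrite xpair_eqE oner_eq0. Qed.

HB.instance Definition _ := GRing.Zmodule_isNzRing.Build unitization
  mulA mul1 mulx1 mulDl mulDr neq10.

Definition augmentation x : F := x.1.
Arguments augmentation : simpl never.

Lemma augmentation_zmod : zmod_morphism augmentation. Proof. by []. Qed.
Lemma augmentation_monoid : monoid_morphism augmentation. Proof. by []. Qed.
HB.instance Definition _ :=
  GRing.isZmodMorphism.Build unitization F augmentation augmentation_zmod.
HB.instance Definition _ :=
  GRing.isMonoidMorphism.Build unitization F augmentation augmentation_monoid.

Definition unitz_in (a : A) : unitization := (0, a).

Lemma unitz_in_zmod : zmod_morphism unitz_in.
Proof. by move=> a b; congr pair; rewrite subr0. Qed.
HB.instance Definition _ :=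
  GRing.isZmodMorphism.Build A unitization unitz_in unitz_in_zmod.

Lemma unitz_inM a b : unitz_in (a ** b) = unitz_in a * unitz_in b.
Proof. by congr pair; rewrite /= ?mul0r // !scale0r !add0r. Qed.

Lemma unitz_mull x a : x * unitz_in a = unitz_in (x.1 *: a + x.2 ** a).
Proof. by congr pair; rewrite /= ?mulr0 // scale0r addr0. Qed.

Lemma unitz_mulr x a : unitz_in a * x = unitz_in (x.1 *: a + a ** x.2).
Proof. by congr pair; rewrite /= ?mul0r // scale0r add0r. Qed.

Lemma unitz_in_inj : injective unitz_in.
Proof. by move=> a b []. Qed.

Lemma augmentation_eq0 x : augmentation x = 0 -> unitz_in x.2 = x.
Proof. by case: x => k a; rewrite /augmentation /= => ->. Qed.

Lemma unitz_inX a n : unitz_in (nuexpS a n) = unitz_in a ^+ n.+1.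
Proof. by elim: n => // n IHn; rewrite exprS -IHn -unitz_inM. Qed.

Lemma augmentation_left_ideal :
  left_ideal *%R [set x | augmentation x = 0].
Proof.
split; first split=> [|x y /= x0 y0]; first exact: rmorph0.
  by rewrite rmorphB /= x0 y0 subrr.
by move=> a x /= x0; rewrite rmorphM /= x0 mulr0.
Qed.

End Unitization.
Arguments augmentation : simpl never.

(** * The Jacobson radical of a unital ring *)

Section UnitalRing.
Variable R : nzRingType.
Implicit Types a b u v x y : R.

(** The left inverse [w] of [v] has to be [u]. *)
Lemma left_inverse_unit u v w : v * u = 1 -> w * v = 1 -> units R u.
Proof.
move=> vu1 wv1; have wu : w = u by rewrite -[w]mulr1 -vu1 mulrA wv1 mul1r.
by exists v; rewrite -{1}wu.
Qed.

Lemma nilpotent_unit1B x : nilpotent R x -> units R (1 - x).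
Proof.
case=> n xn0; pose s := \sum_(i < n) x ^+ i.
have s1 : (1 - x) * s = 1.
  by apply: oppr_inj; rewrite -mulNr opprB /s -subrX1 xn0 sub0r.
exists s; split=> //; rewrite -[RHS]s1; apply/esym.
by apply: commr_sum => i _; apply/commrX/commr_sym/commrB => //; exact: commr1.
Qed.

Lemma nilpotentN x : nilpotent R x -> nilpotent R (- x).
Proof. by case=> n xn0; exists n; rewrite exprNn xn0 mulr0. Qed.

Lemma nilpotent_unit1D x : nilpotent R x -> units R (1 + x).
Proof. by move=> /nilpotentN/nilpotent_unit1B; rewrite opprK. Qed.

Lemma nilpotent_nonunit x : nilpotent R x -> ~ units R x.
Proof.
case=> n xn0 [y [xy1 _]]; suff /eqP : (1 : R) = 0 by rewrite oner_eq0.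
have <- : x ^+ n * y ^+ n = 1; last by rewrite xn0 mul0r.
elim: n {xn0} => [|n IHn]; first by rewrite mulr1.
by rewrite exprSr exprS mulrA -(mulrA _ x y) xy1 mulr1.
Qed.

Lemma nilpotent_monomial x i : nilpotent R x -> nilpotent _ (x%:P * 'X^i).
Proof.
case=> n xn0; exists n; rewrite exprMn_comm; last exact: commr_polyXn.
by rewrite -rmorphXn xn0 mul0r.
Qed.

Lemma left_ideal_setT (M : set R) : left_ideal *%R M -> M 1 -> M = setT.
Proof.
move=> [_ lM] M1; apply/seteqP; split=> // x _.
by rewrite -(mulr1 x); apply: lM.
Qed.

(** Zorn's lemma, applied to the proper left ideals that contain [L]. *)
Lemma proper_left_ideal_maximal (L : set R) :
  left_ideal *%R L -> ~ L 1 -> exists2 M, maximal_left_ideal *%R M & L `<=` M.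
Proof.
move=> iL nL1.
(* The empty set is the union of the empty chain. *)
pose P (M : set R) := M = set0 \/ [/\ left_ideal *%R M, L `<=` M & ~ M 1].
have [F FP totF|M [[M0|[iM LM nM1]] Mmax]] := @Zorn_bigcup R P.
- have [[X FX [x Xx]]|noX] := pselect (exists2 X, F X & X !=set0); last first.
    left; apply/seteqP; split=> // x [X FX Xx]; apply: noX.
    by exists X => //; exists x.
  have FI Y y : F Y -> Y y -> [/\ left_ideal *%R Y, L `<=` Y & ~ Y 1].
    by move=> /FP[->|].
  right; split.
  - split; first split.
    + by exists X => //; have [[[]]] := FI _ _ FX Xx.
    + move=> y z [Y FY Yy] [Z FZ Zz].
      have [[[_ YB] _] _ _] := FI _ _ FY Yy.
      have [[[_ ZB] _] _ _] := FI _ _ FZ Zz.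
      have [YZ|ZY] := totF _ _ FY FZ.
        by exists Z => //; apply: ZB => //; apply: YZ.
      by exists Y => //; apply: YB => //; apply: ZY.
    + move=> a y [Y FY Yy]; exists Y => //.
      by have [[_ lY] _ _] := FI _ _ FY Yy; apply: lY.
  - by move=> y Ly; exists X => //; have [_ + _] := FI _ _ FX Xx; apply.
  - by case=> Y FY Y1; have [_ _] := FI _ _ FY Y1.
- case: (Mmax L); last by right; split.
  split; first by rewrite M0.
  by move=> L0; have := L0 0 iL.1.1; rewrite M0.
exists M => //; split=> //.
  by move=> MT; apply: nM1; rewrite MT.
move=> M' iM' MM'; have [M'1|nM'1] := pselect (M' 1).
  by right; apply: left_ideal_setT.
left; apply/seteqP; split=> // x M'x; apply: contrapT => nMx.
case: (Mmax M'); last by right; split=> // y /LM/MM'.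
by split=> // M'M; apply/nMx/M'M.
Qed.

(** Otherwise the left ideal R(1 - x) lies in a maximal one; this contains
    [x], hence [1]. *)
Lemma jacobson_left_inverse x : jacobson R x -> exists y, y * (1 - x) = 1.
Proof.
move=> Jx; pose L : set R := [set y * (1 - x) | y in setT].
have iL : left_ideal *%R L.
  split; first split=> [|_ _ [y _ <-] [z _ <-]].
  - by exists 0; rewrite ?mul0r.
  - by exists (y - z); rewrite ?mulrBl.
  - by move=> a _ [y _ <-]; exists (a * y); rewrite ?mulrA.
apply: contrapT => nL1.
have [|M mM LM] := proper_left_ideal_maximal iL.
  by case=> y _ y1; apply: nL1; exists y.
have [iM MT _] := mM; apply/MT/left_ideal_setT => //.
rewrite -(subrK x 1); apply: (subgroupD iM.1); last exact: (Jx _ mM).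
by apply: LM; exists 1; rewrite ?mul1r.
Qed.

Lemma jacobson_subgroup : additive_subgroup (jacobson R).
Proof.
split=> [M [iM _ _]|x y Jx Jy M mM]; first exact: subgroup0 iM.1.
have [iM _ _] := mM.
by apply: (subgroupB iM.1); [exact: (Jx _ mM)|exact: (Jy _ mM)].
Qed.

Lemma jacobsonMl a x : jacobson R x -> jacobson R (a * x).
Proof. by move=> Jx M mM; have [[_ lM] _ _] := mM; apply/lM/(Jx _ mM). Qed.

(** If [x] in [L] misses a maximal left ideal M, then M + L is the whole
    ring; from 1 = m + y, the left invertible element 1 - y = m is in M. *)
Lemma left_quasi_regular_jacobson (L : set R) :
  left_ideal *%R L -> (forall x, L x -> exists y, y * (1 - x) = 1) ->
  L `<=` jacobson R.
Proof.
move=> [gL lL] L1 x Lx M [iM MT Mmax]; apply: contrapT => nMx.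
pose M' : set R := [set m + y | m in M & y in L].
have iM' : left_ideal *%R M'.
  split; first split=> [|_ _ [m Mm [y Ly <-]] [m' Mm' [y' Ly' <-]]].
  - exists 0; first exact: subgroup0 iM.1.
    by exists 0; rewrite ?addr0 //; exact: subgroup0.
  - exists (m - m'); first exact: (subgroupB iM.1).
    by exists (y - y'); [exact: subgroupB|rewrite opprD addrACA].
  - move=> a _ [m Mm [y Ly <-]]; exists (a * m); first exact: iM.2.
    by exists (a * y); [exact: lL|rewrite mulrDr].
have [|M'M|M'T] := Mmax M' iM'.
- by move=> m Mm; exists m => //; exists 0; [exact: subgroup0|rewrite addr0].
- apply: nMx; rewrite -M'M; exists 0; first exact: subgroup0 iM.1.
  by exists x; rewrite ?add0r.
have [m Mm [y Ly my1]] : M' 1 by rewrite M'T.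
have [z z1] := L1 y Ly; apply/MT/left_ideal_setT => //.
by rewrite -z1 -my1 addrK; apply: iM.2.
Qed.

(** A left inverse of 1 - x is 1 + yx, and yx is again in the radical, so
    this left inverse has itself a left inverse. *)
Lemma jacobson_unit1B x : jacobson R x -> units R (1 - x).
Proof.
move=> Jx; have [y yx1] := jacobson_left_inverse Jx.
have yE : y = 1 - - (y * x) by rewrite opprK -yx1 mulrBr mulr1 subrK.
have [|w wy1] := @jacobson_left_inverse (- (y * x)).
  by apply: (subgroupN jacobson_subgroup); apply: jacobsonMl.
by apply: (left_inverse_unit (v := y) (w := w)); rewrite // yE.
Qed.

Lemma jacobson_unit1D x : jacobson R x -> units R (1 + x).
Proof.
by move=> /(subgroupN jacobson_subgroup)/jacobson_unit1B; rewrite opprK.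
Qed.

(** If [w] inverts 1 - ay then 1 + y w a inverts 1 - ya. *)
Lemma jacobsonMr a x : jacobson R x -> jacobson R (x * a).
Proof.
move=> Jx; pose L : set R := [set z | exists2 y, jacobson R y & z = y * a].
apply: (@left_quasi_regular_jacobson L); last by exists x.
  split; first split=> [|_ _ [y Jy ->] [z Jz ->]].
  - by exists 0; [exact: (subgroup0 jacobson_subgroup)|rewrite mul0r].
  - exists (y - z); first exact: (subgroupB jacobson_subgroup).
    by rewrite mulrBl.
  - move=> b _ [y Jy ->]; exists (b * y); last by rewrite mulrA.
    exact: jacobsonMl.
move=> _ [y Jy ->].
have [w [_ w1]] := jacobson_unit1B (jacobsonMl a Jy).
exists (1 + y * w * a); rewrite mulrDl mul1r.
have -> : y * w * a * (1 - y * a) = y * (w * (1 - a * y)) * a.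
  by rewrite !(mulrBr, mulr1, mulrBl) !mulrA.
by rewrite w1 mulr1 subrK.
Qed.

Lemma UJ_ringP : UJ_ring R <-> forall u, units R u -> jacobson R (u - 1).
Proof.
split=> [UJ u|UJ].
  by rewrite UJ => -[j Jj <-]; rewrite addrC addKr.
apply/seteqP; split=> [u /UJ Ju|_ [j Jj <-]]; last exact: jacobson_unit1D.
by exists (u - 1); rewrite // addrC subrK.
Qed.

Section UJNil.
Hypotheses (UJ : UJ_ring R) (nJ : jacobson R `<=` nilpotent R).

(** Together with [nJ], the radical is the set of all nilpotent elements. *)
Lemma UJ_nilpotent_jacobson x : nilpotent R x -> jacobson R x.
Proof.
move=> /nilpotent_unit1D; move/UJ_ringP : UJ => /[apply].
by rewrite addrC addKr.
Qed.

(** The ring R/J is reduced: its nilpotent elements come from nilpotent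
    elements of R, as J is nil. *)
Lemma UJ_jacobson_sqr x : jacobson R (x * x) -> jacobson R x.
Proof.
move=> /nJ[n xxn]; apply: UJ_nilpotent_jacobson; exists (2 * n)%N.
by rewrite exprM expr2.
Qed.

(** As -1 is a unit, -2 is in the radical. *)
Lemma UJ_nilpotent2 : nilpotent R 2.
Proof.
apply: nJ; rewrite -[2]opprK; apply: (subgroupN jacobson_subgroup).
have : units R (-1) by exists (-1); rewrite mulrNN mulr1.
by move/UJ_ringP : UJ => /[apply]; rewrite -opprD.
Qed.

End UJNil.

End UnitalRing.

(** * Polynomials over the unitization *)

Section NuPoly.
Variable A : nuRingType.
Implicit Types p q : nupoly A.

Definition nupoly_bound p : nat := (\max_(i <- msupp p) i).+1.

Lemma nupoly_boundP p i : (nupoly_bound p <= i)%N -> p@_i = 0.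
Proof.
move=> lt_i; apply: mcoeff_outdom; apply/negP => pi.
have := leq_bigmax_seq (P := xpredT) (F := id) _ pi isT => /=.
by rewrite leqNgt lt_i.
Qed.

(** Polynomials given by their coefficients, as with [\poly_(i < n) a i]. *)
Definition nupoly_of (n : nat) (a : nat -> A) : nupoly A :=
  \sum_(i < n) << a i *g val i >>.

Lemma coef_nupoly_of n a i :
  (nupoly_of n a)@_i = if (i < n)%N then a i else 0.
Proof.
rewrite raddf_sum /=; under eq_bigr do rewrite mcoeffU.
case: ltnP => [lt_in|le_ni].
  rewrite (bigD1 (Ordinal lt_in)) //= eqxx mulr1n big1 ?addr0 // => j ji.
  have -> : (val j == i) = (j == Ordinal lt_in) by [].
  by rewrite (negPf ji).
rewrite big1 // => j _; case: eqP => // ji.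
by move: (ltn_ord j); rewrite ji ltnNge le_ni.
Qed.

Lemma coef_nupolyM p q n :
  (p ** q)@_n = \sum_(i < n.+1) p@_(val i) ** q@_(n - i)%N.
Proof. exact: coef_nupoly_mul. Qed.

Definition nupolyC (a : A) : nupoly A := << a *g 0%N >>.

Lemma coef_nupolyC a i : (nupolyC a)@_i = if i == 0%N then a else 0.
Proof. by rewrite mcoeffU eq_sym; case: eqP. Qed.

Lemma circ_nupolyC a b : circ (nupolyC a) (nupolyC b) = nupolyC (circ a b).
Proof.
apply/malgP => n; rewrite mcoeffB mcoeffD coef_nupolyM !coef_nupolyC.
case: n => [|n] /=.
  by rewrite big_ord1 !coef_nupolyC.
rewrite big1 ?addr0 ?subr0 // => -[[|i] lt_i] _ /=.
  by rewrite !coef_nupolyC subn0 numul0.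
by rewrite coef_nupolyC nu0mul.
Qed.

End NuPoly.

Section UnitizationPoly.
Variables (F : fieldType) (A : nuAlgType F).
Implicit Types p q : nupoly A.

Definition unitz_poly p : {poly unitization A} :=
  \poly_(i < nupoly_bound p) unitz_in p@_i.

Lemma coef_unitz_poly p i : (unitz_poly p)`_i = unitz_in p@_i.
Proof.
rewrite coef_poly; case: ltnP => // /nupoly_boundP->.
by rewrite raddf0.
Qed.

Lemma unitz_poly_inj : injective unitz_poly.
Proof.
move=> p q epq; apply/malgP => i; apply/unitz_in_inj.
by rewrite -!coef_unitz_poly epq.
Qed.

Lemma unitz_poly_circ p q :
  1 - unitz_poly (circ p q) = (1 - unitz_poly p) * (1 - unitz_poly q).
Proof.
have -> : unitz_poly (circ p q)
    = unitz_poly p + unitz_poly q - unitz_poly p * unitz_poly q.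
  apply/polyP => i; rewrite !(coefN, coefD, coef_unitz_poly) coefM.
  rewrite mcoeffB mcoeffD coef_nupolyM raddfB raddfD /=; congr (_ - _).
  rewrite raddf_sum; apply: eq_bigr => j _.
  by rewrite !coef_unitz_poly -unitz_inM.
rewrite mulrBl mul1r mulrBr mulr1 !opprB -addrA; congr (_ + _).
by rewrite opprD addrA addrC.
Qed.

(** Modulo A, 1 - p is equal to 1, so the inverse [v] is also 1 modulo A: it
    comes from a polynomial over A. *)
Lemma unitz_poly_right_inverse p (v : {poly unitization A}) :
  (1 - unitz_poly p) * v = 1 -> exists q, circ p q = 0.
Proof.
move=> pv1; pose q := nupoly_of (size (1 - v)) (fun i => ((1 - v)`_i).2).
have v_aug : map_poly (@augmentation F A) v = 1.
  have p_aug : map_poly (@augmentation F A) (unitz_poly p) = 0.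
    by apply/polyP => i; rewrite coef_map /= coef_unitz_poly coef0.
  have := congr1 (map_poly (@augmentation F A)) pv1.
  by rewrite rmorphM rmorphB !rmorph1 /= p_aug subr0 mul1r.
have qE : unitz_poly q = 1 - v.
  apply/polyP => i; rewrite coef_unitz_poly coef_nupoly_of.
  case: ltnP => [_|/(nth_default 0)->]; last by rewrite raddf0.
  apply: augmentation_eq0; rewrite -coef_map rmorphB rmorph1 /= v_aug subrr.
  exact: coef0.
exists q; apply: unitz_poly_inj; apply: oppr_inj; apply: (addrI 1).
rewrite unitz_poly_circ qE subKr pv1.
rewrite (_ : unitz_poly 0 = 0) ?subr0 //.
by apply/polyP => i; rewrite coef_unitz_poly mcoeff0 raddf0 coef0.
Qed.

End UnitizationPoly.

Section UnitizationNil.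
Variables (A : nuAlgType 'F_2).
Hypothesis nilA : nil_nuring A.
Implicit Types x : unitization A.

Lemma augmentation_nilpotent x : augmentation x = 0 -> nilpotent _ x.
Proof.
move=> /augmentation_eq0 <-; have [n an0] := nilA x.2.
by exists n.+1; rewrite -unitz_inX an0 raddf0.
Qed.

Lemma augmentation_jacobson x : augmentation x = 0 -> jacobson _ x.
Proof.
apply: (@left_quasi_regular_jacobson _ [set x | augmentation x = 0]).
  exact: augmentation_left_ideal.
move=> y /augmentation_nilpotent/nilpotent_unit1B[z [_ z1]].
by exists z.
Qed.

Lemma unitization_UJ : UJ_ring (unitization A).
Proof.
apply/UJ_ringP => u uU; apply: augmentation_jacobson.
rewrite rmorphB rmorph1 /=.
have [u0|->] := F2_cases (augmentation u); last exact: subrr.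
by case: (nilpotent_nonunit (augmentation_nilpotent u0)).
Qed.

Lemma unitization_jacobson_nil :
  jacobson (unitization A) `<=` nilpotent (unitization A).
Proof.
move=> x Jx; apply: augmentation_nilpotent.
have [//|x1] := F2_cases (augmentation x).
have [] := nilpotent_nonunit _ (jacobson_unit1B Jx).
by apply: augmentation_nilpotent; rewrite rmorphB rmorph1 /= x1 subrr.
Qed.

(** Each monomial of [p] is nilpotent, and the radical of a UJ-ring contains
    its nilpotent elements. *)
Lemma UJ_poly_jacobson (p : nupoly A) :
  UJ_ring {poly unitization A} -> jacobson _ (unitz_poly p).
Proof.
move=> UJ; rewrite -[unitz_poly p]coefK poly_def.
apply: (subgroup_sum (@jacobson_subgroup _)) => i _; rewrite -mul_polyC.
apply: (UJ_nilpotent_jacobson UJ); apply: nilpotent_monomial.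
by apply: augmentation_nilpotent; rewrite coef_unitz_poly.
Qed.

Lemma UJ_poly_radical :
  UJ_ring {poly unitization A} -> nujacobson (nupoly A) = setT.
Proof.
move=> UJ; apply/nujacobsonTP/right_circ_quasi_regular => p.
have [v [pv1 _]] := jacobson_unit1B (UJ_poly_jacobson p UJ).
exact: unitz_poly_right_inverse pv1.
Qed.

End UnitizationNil.

(** * Matrices over a radical polynomial ring *)

Section NuMatrix.
Variables (A : nuRingType) (n : nat).
Implicit Types M N : 'M[A]_n.

Lemma numxE M N i j : (M ** N) i j = \sum_k M i k ** N k j.
Proof. by rewrite mxE. Qed.

Definition column_support (s : pred 'I_n) : set 'M[A]_n :=
  [set M | forall i j, ~~ s j -> M i j = 0].

Lemma column_support_left_ideal s : left_ideal numul (column_support s).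
Proof.
split; first split=> [i j _|M N sM sN i j sj]; first by rewrite mxE.
  by rewrite !mxE sM ?sN ?subr0.
move=> M N sN i j sj; rewrite numxE big1 // => k _.
by rewrite sN // numul0.
Qed.

(** Left multiplication by a matrix supported on column [j] only sees row
    [j]; in particular M |-> M_jj is multiplicative on such matrices. *)
Lemma column_mulE j M N i : column_support (pred1 j) M ->
  (M ** N) i j = M i j ** N j j.
Proof.
move=> jM; rewrite numxE (bigD1 j) //= big1 ?addr0 // => k kj.
by rewrite jM ?nu0mul.
Qed.

Definition mx_column j M : 'M[A]_n :=
  \matrix_(i, k) if k == j then M i k else 0.

Lemma mx_column_support j M : column_support (pred1 j) (mx_column j M).
Proof. by move=> i k kj; rewrite mxE -[k == j]/(pred1 j k) (negPf kj). Qed.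

Lemma mx_column_sum M : M = \sum_j mx_column j M.
Proof.
apply/matrixP => i j; rewrite summxE (bigD1 j) //= mxE eqxx.
by rewrite big1 ?addr0 // => k /negPf kj; rewrite mxE eq_sym kj.
Qed.

End NuMatrix.

Section MatrixQuasiRegular.
Variables (A : nuRingType) (n : nat).
Hypothesis qA : forall a : A, quasi_regular A a.
Implicit Types M N : 'M[A]_n.

(** If M has the single column c and (1 - b)(1 - c_j) = 1, the column
    d = - c(1 - b) satisfies d(1 - c_j) = - c, that is N + M - N M = 0 for
    the matrix N with single column d. *)
Lemma column_left_quasi_regular j M : column_support (pred1 j) M ->
  exists N, circ N M = 0.
Proof.
move=> jM; have [b [_ ba0]] := qA (M j j).
pose N : 'M[A]_n :=
  \matrix_(i, k) if k == j then M i j ** b - M i j else 0.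
exists N; apply/matrixP => i k; rewrite !mxE.
have jN : column_support (pred1 j) N.
  by move=> i' k' k'j; rewrite mxE -[k' == j]/(pred1 j k') (negPf k'j).
case: (eqVneq k j) => [->|kj]; last first.
  rewrite jM // big1 ?addr0 ?subrr // => l _.
  by rewrite jM // numul0.
rewrite -numxE column_mulE // mxE eqxx subrK numulDl nuNmul opprB.
by rewrite -numulA -numulN -!numulDr addrA [b + _ - _]ba0 numul0.
Qed.

(** Columns are handled one at a time. If N1 is a left quasi-inverse of the
    first columns X of M = X + Y, then N1 o M = Y - N1 Y is supported on the
    columns of Y. *)
Lemma matrix_left_quasi_regular M : exists N, circ N M = 0.
Proof.
suff lqr k : forall M, column_support (fun j => j < k)%N M ->
    exists N, circ N M = 0.
  by apply: (lqr n) => i j; rewrite ltn_ord.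
elim: k => [|k IHk] {}M kM.
  exists 0; rewrite circ0a; apply/matrixP => i j.
  by rewrite kM // mxE.
have [lt_kn|le_nk] := ltnP k n; last first.
  by apply: IHk => i j; rewrite (leq_trans (ltn_ord j) le_nk).
pose j0 := Ordinal lt_kn; pose Y := mx_column j0 M.
have [|N1 N1E] := IHk (M - Y).
  move=> i j; rewrite -leqNgt !mxE leq_eqVlt => /predU1P[kj|lt_kj].
    by rewrite ifT ?subrr // -val_eqE /= kj.
  rewrite kM ?if_same ?subrr //; first by rewrite -leqNgt.
have [gY lY] := @column_support_left_ideal A n (pred1 j0).
have [|N2 N2E] := @column_left_quasi_regular j0 (Y - N1 ** Y).
  by apply: (subgroupB gY); [|apply: lY]; exact: mx_column_support.
exists (circ N2 N1); rewrite -circA -[RHS]N2E; congr circ.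
rewrite -[Y - _]add0r -N1E /circ -[in LHS](subrK Y M) numulDr opprD.
by rewrite [RHS]addrACA -[N1 + _ + Y]addrA.
Qed.

End MatrixQuasiRegular.

Section MatrixPowers.
Variables (A : nuRingType) (n : nat).
Hypothesis qA : forall p : nupoly A, quasi_regular (nupoly A) p.
Implicit Types M : 'M[A]_n.

Lemma coef_nupolyMX (p : nupoly A) a k :
  (p ** (<< a *g 1%N >> : nupoly A))@_k
    = if k is k'.+1 then p@_k' ** a else 0.
Proof.
rewrite coef_nupolyM; case: k => [|k].
  by rewrite big_ord1 mcoeffU /= numul0.
rewrite big_ord_recr big_ord_recr /= big1 ?add0r => [|i _].
  by rewrite !mcoeffU subnn subSnn /= numul0 addr0.
have le_ik : (i <= k)%N := ltnW (ltn_ord i).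
by rewrite mcoeffU subSn //= eqSS eq_sym subn_eq0 leqNgt ltn_ord numul0.
Qed.

(** If (1 - N)(1 - M x) = 1, comparing coefficients gives that of x^(k+1) in
    N as - M^(k+1); it vanishes for large k. *)
Lemma quasi_regular_poly_nilpotent M : nunilpotent 'M[A]_n M.
Proof.
pose P : 'M[nupoly A]_n := \matrix_(i, j) << M i j *g 1%N >>.
have [N NP0] := matrix_left_quasi_regular qA P.
pose c k : 'M[A]_n := \matrix_(i, j) (N i j)@_k.
have NPE i j k : (N i j)@_k + (P i j)@_k
    = if k is k'.+1 then (c k' ** M) i j else 0.
  have /matrixP/(_ i j) := NP0; rewrite !mxE => /eqP.
  rewrite subr_eq0 => /eqP/(congr1 (mcoeff k)); rewrite mcoeffD => ->.
  rewrite raddf_sum /=; under eq_bigr do rewrite mxE coef_nupolyMX.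
  case: k => [|k]; first by rewrite big1.
  by rewrite numxE; apply: eq_bigr => l _; rewrite mxE.
have c0 : c 0%N = 0.
  apply/matrixP => i j; have := NPE i j 0%N.
  by rewrite !mxE mcoeffU addr0.
have cE k : c k.+1 = - nuexpS M k.
  elim: k => [|k IHk]; apply/matrixP => i j.
    have := NPE i j 1%N; rewrite c0 nu0mul !mxE mcoeffU eqxx.
    by move/eqP; rewrite addr_eq0 => /eqP.
  have := NPE i j k.+2; rewrite IHk nuNmul -nuexpSr.
  by rewrite [P i j]mxE mcoeffU addr0 => NE; rewrite mxE NE.
pose K := \max_(ij : 'I_n * 'I_n) nupoly_bound (N ij.1 ij.2).
exists K; apply: oppr_inj; rewrite -cE oppr0; apply/matrixP => i j.
rewrite !mxE; apply: nupoly_boundP; apply: leqW.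
exact: (bigmax_sup (i, j)).
Qed.

End MatrixPowers.

(** * Nil one-sided ideals and nil matrices *)

Lemma nualg2 (A : nuAlgType 'F_2) (a : A) : a + a = 0.
Proof.
have F2_11 : 1 + 1 = 0 :> 'F_2 by apply: val_inj.
by rewrite -[a]scale1r -scalerDl F2_11 scale0r.
Qed.

Lemma subgroupZ (A : nuAlgType 'F_2) (I : set A) (k : 'F_2) a :
  additive_subgroup I -> I a -> I (k *: a).
Proof.
move=> gI Ia; case: (F2_cases k) => ->; last by rewrite scale1r.
by rewrite scale0r; apply: subgroup0.
Qed.

Definition nil_matrices :=
  forall A : nuAlgType 'F_2, nil_nuring A ->
  forall n, (1 <= n)%N -> nil_nuring 'M[A]_n.

Section MapMatrixPowers.
Variables (F : fieldType) (A : nuAlgType F) (n : nat).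

Lemma map_unitz_inX (M : 'M[A]_n) k :
  map_mx (@unitz_in F A) (nuexpS M k) = map_mx (@unitz_in F A) M ^+ k.+1.
Proof.
elim: k => [|k IHk]; first by rewrite expr1.
rewrite exprS -IHk; apply/matrixP => i j; rewrite !mxE raddf_sum.
by apply: eq_bigr => l _; rewrite !mxE; exact: unitz_inM.
Qed.

End MapMatrixPowers.

(** This turns powers of a product c d of rectangular matrices, such as a
    row by a column, into powers of d c. *)
Lemma mulmx_exp_swap (R : pzRingType) m n (c : 'M[R]_(m, n)) (d : 'M[R]_(n, m))
    k : (c *m d) ^+ k.+1 = c *m (d *m c) ^+ k *m d.
Proof.
elim: k => [|k IHk]; first by rewrite expr1 expr0 mulmx1.
rewrite exprS IHk [(d *m c) ^+ k.+1]exprS.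
by rewrite -!mulmxE !mulmxA.
Qed.

Section NilSubring.
Hypothesis nilM : nil_matrices.
Variables (A : nuAlgType 'F_2) (S : set A).
Hypotheses (gS : additive_subgroup S)
  (mulS : forall x y, S x -> S y -> S (x ** y)) (nilS : S `<=` nunilpotent A).

(** The hypothesis on nil algebras applies to [S] through a copy of it, the
    subquotient S/0. *)
Lemma nil_subring_matrix n (M : 'M[A]_n) :
  (forall i j, S (M i j)) -> nunilpotent 'M[A]_n M.
Proof.
move=> SM; case: n => [|n] in M SM *.
  by exists 0%N; rewrite [LHS]flatmx0 [RHS]flatmx0.
have [|||x Sx|B [f fP]] := subquotient_exists
  (@numulA A) (@numulDl A) (@numulDr A) gS mulS (I := [set 0]).
- by split=> // x y -> ->; apply: subr0.
- by move=> s x _ ->; apply: numul0.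
- by move=> s x _ ->; apply: nu0mul.
- exact: nualg2.
have fX s k : S s -> S (nuexpS s k) /\ f (nuexpS s k) = nuexpS (f s) k.
  move=> Ss; elim: k => //= k [Sk fk]; split; first exact: mulS.
  by rewrite (subquotientM fP) // fk.
have nilB : nil_nuring B.
  move=> b; have [s Ss <-] := subquotient_surj fP b.
  have [k sk0] := nilS Ss; exists k.
  by rewrite -(fX s k Ss).2 sk0 (subquotient0 gS fP).
have [k Mk0] := nilM nilB (ltn0Sn n) (map_mx f M).
exists k; have MX l : (forall i j, S (nuexpS M l i j)) /\
    map_mx f (nuexpS M l) = nuexpS (map_mx f M) l.
  elim: l => // l [Sl fl]; have SMl i j r : S (M i r ** nuexpS M l r j).
    by apply: mulS.
  split=> [i j|]; first by rewrite [nuexpS _ _]/= numxE; apply: subgroup_sum.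
  apply/matrixP => i j; rewrite [nuexpS (map_mx _ _) _]/= -fl numxE !mxE.
  rewrite [LHS](subquotient_sum gS fP) //; apply: eq_bigr => r _.
  by rewrite (subquotientM fP) ?mxE.
apply/matrixP => i j; rewrite mxE; apply: (subquotient_eq0 fP _).1.
  exact: (MX k).1.
by have /matrixP/(_ i j) := (MX k).2; rewrite Mk0 !mxE.
Qed.

Variables (P Q : set (unitization A)).
Hypotheses (mulP : forall a x, P x -> P (a * x))
  (mulQ : forall a x, Q x -> Q (x * a))
  (mulQP : forall x y, Q x -> P y -> exists2 s, S s & x * y = unitz_in s).

(** The sums of products p q with p in [P] and q in [Q], each written as a
    row times a column so that [mulmx_exp_swap] applies. One of [P] and [Q]
    will be a one-sided ideal L of A and the other one the whole of A^#:
    this is the two-sided ideal L A^# or A^# L. *)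
Definition product_ideal : set A :=
  [set x | exists n (c : 'rV_n) (d : 'cV_n),
    [/\ forall i, P (c 0 i), forall i, Q (d i 0)
      & c *m d = (unitz_in x)%:M]].

Lemma product_ideal_two_sided : two_sided_ideal numul product_ideal.
Proof.
have gI : additive_subgroup product_ideal.
  split=> [|x y [n [c [d [Pc Qd xE]]]] [m [c' [d' [Pc' Qd' yE]]]]].
    exists 0%N, 0, 0; split; try by case.
    by rewrite mulmx0 !raddf0.
  exists (n + m)%N, (row_mx c (- c')), (col_mx d d'); split=> [i|i|].
  - rewrite mxE; case: split => // j; rewrite mxE -mulN1r; exact: mulP.
  - by rewrite mxE; case: split.
  - by rewrite mul_row_col mulNmx xE yE !raddfB.
split; split=> // a x [n [c [d [Pc Qd xE]]]].
  exists n, ((unitz_in a)%:M *m c), d; split=> // [i|].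
    by rewrite mul_scalar_mx mxE; apply: mulP.
  by rewrite -mulmxA xE -scalar_mxM unitz_inM.
exists n, c, (d *m (unitz_in a)%:M); split=> // [i|].
  by rewrite mxE big_ord1 !mxE eqxx; apply: mulQ.
by rewrite mulmxA xE -scalar_mxM unitz_inM.
Qed.

Lemma product_idealM x p q :
  P p -> Q q -> unitz_in x = p * q -> product_ideal x.
Proof.
move=> Pp Qq xpq; exists 1%N, p%:M, q%:M; split=> [i|i|].
- by rewrite ord1 mxE eqxx.
- by rewrite ord1 mxE eqxx.
- by rewrite -scalar_mxM xpq.
Qed.

(** If x = c d then x^(k+2) = c (d c)^(k+1) d, and the entries of d c are in
    the nil ring [S]. *)
Lemma product_ideal_nil : product_ideal `<=` nunilpotent A.
Proof.
move=> x [n [c [d [Pc Qd xE]]]].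
pose M : 'M[A]_n := \matrix_(i, j) (d i 0 * c 0 j).2.
have ME i j : S (M i j) /\ unitz_in (M i j) = d i 0 * c 0 j.
  by rewrite mxE; have [s Ss ->] := mulQP (Qd i) (Pc j).
have [|k Mk0] := @nil_subring_matrix n M; first by move=> i j; case: (ME i j).
have dcE : map_mx (@unitz_in _ A) M = d *m c.
  by apply/matrixP => i j; rewrite [RHS]mxE big_ord1 mxE; case: (ME i j).
exists k.+1; apply: unitz_in_inj; rewrite unitz_inX.
have /matrixP/(_ 0 0) : ((unitz_in x) ^+ k.+2)%:M = (0 : 'M[unitization A]_1).
  rewrite rmorphXn /= -xE mulmx_exp_swap -dcE -map_unitz_inX Mk0.
  by rewrite map_mx0 mulmx0 mul0mx.
by rewrite !mxE eqxx raddf0.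
Qed.

End NilSubring.

Lemma nil_matrices_kothe (A : nuAlgType 'F_2) :
  nil_matrices -> kothe_property A.
Proof.
move=> nilM noI L oneL nilL.
have gL : additive_subgroup L by case: oneL => -[].
pose U := unitization A; pose inL : set U := [set unitz_in l | l in L].
suff [P [Q [mulP mulQ mulQP LPQ]]] : exists P Q : set U,
    [/\ forall a x, P x -> P (a * x), forall a x, Q x -> Q (x * a),
        forall x y, Q x -> P y -> inL (x * y)
      & forall l, L l -> product_ideal P Q l].
  have L2 x y : L x -> L y -> L (x ** y).
    by case: oneL => -[_ mulL] Lx Ly; apply: mulL.
  have {}mulQP x y : Q x -> P y -> exists2 s, L s & x * y = unitz_in s.
    by move=> Qx Py; have [s Ls <-] := mulQP x y Qx Py; exists s.
  have I0 := noI _ (product_ideal_two_sided mulP mulQ)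
    (product_ideal_nil nilM gL L2 nilL mulQP).
  apply/seteqP; split=> [l /LPQ|_ ->]; last exact: subgroup0.
  by rewrite I0.
case: oneL => -[_ mulL].
  have mul_inL (a x : U) : inL x -> inL (a * x).
    case=> l Ll <-; exists (a.1 *: l + a.2 ** l); last by rewrite unitz_mull.
    by apply: subgroupD => //; [exact: subgroupZ|exact: mulL].
  exists inL, setT; split=> // [x y _ /mul_inL //|l Ll].
  apply: (@product_idealM _ _ _ _ (unitz_in l) 1); rewrite ?mulr1 //.
  by exists l.
have mul_inL (a x : U) : inL x -> inL (x * a).
  case=> l Ll <-; exists (a.1 *: l + l ** a.2); last by rewrite unitz_mulr.
  by apply: subgroupD => //; [exact: subgroupZ|exact: mulL].
exists setT, inL; split=> // [x y /mul_inL //|l Ll].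
apply: (@product_idealM _ _ _ _ 1 (unitz_in l)); rewrite ?mul1r //.
by exists l.
Qed.

(** * The upper nilradical and matrix columns *)

Section UpperNilradical.
Variable B : nuRingType.
Implicit Types (x y : B) (I J : set B).

Definition nil_ideal I := two_sided_ideal numul I /\ I `<=` nunilpotent B.

(** The largest nil ideal. *)
Definition upper_nilradical : set B :=
  [set x | exists2 I, nil_ideal I & I x].

(** Modulo [J], x + y and x are equal. *)
Lemma nuexpS_add_ideal J x y n : two_sided_ideal numul J -> J y ->
  J (nuexpS (x + y) n - nuexpS x n).
Proof.
move=> [[gJ lJ] [_ rJ]] Jy; elim: n => [|n IHn]; first by rewrite addrC addKr.
have -> : nuexpS (x + y) n.+1 - nuexpS x n.+1
    = x ** (nuexpS (x + y) n - nuexpS x n) + y ** nuexpS (x + y) n.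
  by rewrite /= numulDl numulDr numulN addrAC.
by apply: subgroupD gJ _ _ (lJ _ _ _) (rJ _ _ _).
Qed.

(** A power of x + y is in [J] as soon as the same power of x vanishes. *)
Lemma nil_ideal_add I J : nil_ideal I -> nil_ideal J ->
  nil_ideal [set x + y | x in I & y in J].
Proof.
move=> [iI nI] [iJ nJ]; have [[gI lI] [_ rI]] := iI.
have [[gJ lJ] [_ rJ]] := iJ.
have gIJ : additive_subgroup [set x + y | x in I & y in J].
  split=> [|_ _ [x1 Ix1 [y1 Jy1 <-]] [x2 Ix2 [y2 Jy2 <-]]].
    by exists 0; [exact: gI.1 | exists 0; [exact: gJ.1 | exact: addr0]].
  exists (x1 - x2); first exact: gI.2.
  by exists (y1 - y2); [exact: gJ.2 | rewrite opprD addrACA].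
split.
  split; split=> // a _ [x Ix [y Jy <-]].
    exists (a ** x); first exact: lI.
    by exists (a ** y); [exact: lJ|rewrite numulDr].
  exists (x ** a); first exact: rI.
  by exists (y ** a); [exact: rJ|rewrite numulDl].
move=> _ [x Ix [y Jy <-]]; have [n xn0] := nI _ Ix.
apply: (@nunilpotent_nuexpS _ _ n); apply: nJ.
by rewrite -[nuexpS _ _]subr0 -xn0; apply: nuexpS_add_ideal.
Qed.

Lemma upper_nilradical_ideal : nil_ideal upper_nilradical.
Proof.
split; last by move=> x [I [_ nI] /nI].
have gN : additive_subgroup upper_nilradical.
  split=> [|x y [I iI Ix] [J iJ Jy]].
    exists [set 0] => //; split; last by move=> _ ->; exists 0%N.
    have g0 : additive_subgroup [set 0 : B].
      by split=> // x y -> ->; exact: subr0.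
    by split; split=> // a _ ->; [exact: numul0 | exact: nu0mul].
  exists [set x + y | x in I & y in J]; first exact: nil_ideal_add.
  exists x => //; exists (- y) => //.
  by have [[[gJ _] _] _] := iJ; apply: subgroupN.
split; split=> // a x [I iI Ix]; exists I => //; have [[[_ lI] [_ rI]] _] := iI.
  exact: lI.
exact: rI.
Qed.

(** The quotient of B by its upper nilradical has no nonzero nil ideal,
    because the preimage of a nil ideal is nil. So the image of [L], which
    is a nil left ideal of it, vanishes. *)
Lemma kothe_upper_nilradical L :
  (forall A : nuAlgType 'F_2, kothe_property A) -> (forall x, x + x = 0) ->
  left_ideal numul L -> L `<=` nunilpotent B -> L `<=` upper_nilradical.
Proof.
move=> kothe B2 [gL lL] nL.
have [[[gN lN] [_ rN]] nN] := upper_nilradical_ideal.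
have gT : additive_subgroup [set: B] by [].
have [|s x _|s x _|x _|C [f fP]] := subquotient_exists (S := setT)
  (@numulA B) (@numulDl B) (@numulDr B) gT _ gN.
- by [].
- exact: lN.
- exact: rN.
- by rewrite B2; apply: subgroup0.
have fX x n : f (nuexpS x n) = nuexpS (f x) n.
  by elim: n => //= n <-; rewrite (subquotientM fP).
have fN x : f x = 0 <-> upper_nilradical x by apply: (subquotient_eq0 fP).
have noK K : two_sided_ideal (@numul C) K -> K `<=` nunilpotent C ->
    K = [set 0].
  move=> [[gK lK] [_ rK]] nK.
  have iK : nil_ideal (f @^-1` K).
    have gfK : additive_subgroup (f @^-1` K).
      split=> [|x y Kx Ky]; rewrite /preimage /=.
        by rewrite (subquotient0 gT fP); apply: subgroup0.
      by rewrite (subquotientB fP) //; apply: subgroupB.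
    split; first split; first split=> // a x.
    - by rewrite /preimage /= (subquotientM fP) //; apply: lK.
    - by split=> // a x; rewrite /preimage /= (subquotientM fP) //; apply: rK.
    move=> x /nK[n]; rewrite -fX fN => /nN; exact: nunilpotent_nuexpS.
  apply/seteqP; split=> [c|_ ->]; last exact: subgroup0.
  have [x _ <-] := subquotient_surj fP c.
  by move=> Kfx; apply/fN; exists (f @^-1` K).
move=> x Lx; apply/fN.
suff fL0 : f @` L = [set 0] by rewrite -[_ = 0]/([set 0] (f x)) -fL0; exists x.
apply: (kothe C noK); last first.
  by move=> _ [y /nL[n yn0] <-]; exists n; rewrite -fX yn0 (subquotient0 gT fP).
left; split; first split=> [|_ _ [y Ly <-] [z Lz <-]].
- by exists 0; [exact: subgroup0|exact: (subquotient0 gT fP)].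
- by exists (y - z); [exact: subgroupB|rewrite (subquotientB fP)].
- move=> c _ [y Ly <-]; have [b _ <-] := subquotient_surj fP c.
  by exists (b ** y); [exact: lL|rewrite (subquotientM fP)].
Qed.

End UpperNilradical.

Section ColumnNil.
Variables (A : nuRingType) (n : nat).
Implicit Types M : 'M[A]_n.

(** The entries of M^(k+2) in column [j] are the M_ij M_jj^(k+1). *)
Lemma column_nilpotent j M : nil_nuring A -> column_support (pred1 j) M ->
  nunilpotent 'M[A]_n M.
Proof.
move=> nilA jM; have [k Mk0] := nilA (M j j).
have MX l : nuexpS M l j j = nuexpS (M j j) l.
  by elim: l => // l IHl; rewrite [LHS]column_mulE // IHl.
have jMX l : column_support (pred1 j) (nuexpS M l).
  elim: l => // l IHl.
  by have [_ lI] := @column_support_left_ideal A n (pred1 j); apply: lI.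
exists k.+1; apply/matrixP => i l; rewrite [RHS]mxE.
have [->|lj] := eqVneq l j; last exact: (jMX k.+1).
by rewrite [LHS]column_mulE // MX Mk0 numul0.
Qed.

End ColumnNil.

Lemma kothe_nil_matrices :
  (forall A : nuAlgType 'F_2, kothe_property A) -> nil_matrices.
Proof.
move=> kothe A nilA n _ M.
have [[[gN _] _] nN] := @upper_nilradical_ideal 'M[A]_n.
apply: nN; rewrite (mx_column_sum M); apply: subgroup_sum => // j _.
apply: (@kothe_upper_nilradical _ (column_support (pred1 j)) kothe).
- by move=> N; apply/matrixP => i k; rewrite !mxE nualg2.
- exact: column_support_left_ideal.
- by move=> N; apply: column_nilpotent.
- exact: mx_column_support.
Qed.

(** * Companion matrices *)

Section Companion.
Variables (F : fieldType) (A : nuAlgType F).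
Hypothesis nilM : forall n, (1 <= n)%N -> nil_nuring 'M[A]_n.
Variable p : nupoly A.
Hypothesis p0 : p@_0%N = 0.

Let n := nupoly_bound p.
Let U := unitization A.

(** The companion matrix of p = a_1 x + a_2 x^2 + ...: first row a_1, a_2,
    ..., and ones below the diagonal. If c_k are the coefficients of the
    series (1 - p)^(-1), it maps (c_k, c_(k-1), ...) to (c_(k+1), c_k, ...). *)
Definition companion : 'M[U]_n.+1 :=
  \matrix_(i, j) if i == 0 then unitz_in p@_j.+1 else (val i == j.+1)%:R.

(** Modulo A the companion matrix is the shift, whose power n + 1 vanishes;
    so the power n + 1 of the companion matrix has its entries in the nil
    algebra A. *)
Lemma companion_nilpotent : exists k, companion ^+ k = 0.
Proof.
pose aug := map_mx (@augmentation F A) : 'M[U]_n.+1 -> 'M_n.+1.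
have augX k i j : aug (companion ^+ k) i j = (val i == j + k)%N%:R.
  elim: k i j => [|k IHk] i j.
    by rewrite /aug /= expr0 !mxE addn0 rmorph_nat.
  rewrite /aug exprS rmorphM -/aug mxE.
  have augC l : aug companion i l = (val i == l.+1)%:R.
    by rewrite !mxE; case: eqP => [->|_]; rewrite ?rmorph_nat.
  case: (unliftP ord0 i) augC => [i'|] -> augC; last first.
    by rewrite big1 ?addnS // => l _; rewrite augC mul0r.
  rewrite (bigD1 (widen_ord (leqnSn n) i')) //= big1 => [|l li'].
    by rewrite augC IHk eqxx mul1r addr0 addnS.
  rewrite augC [_ == _](_ : _ = false) ?mul0r //.
  by apply: contraNF li' => /eqP[li']; apply/eqP/val_inj.
pose X : 'M[A]_n.+1 := \matrix_(i, j) ((companion ^+ n.+1) i j).2.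
have XE : map_mx (@unitz_in F A) X = companion ^+ n.+1.
  apply/matrixP => i j; rewrite [LHS]mxE [X i j]mxE; apply: augmentation_eq0.
  have := augX n.+1 i j; rewrite [LHS]mxE => ->.
  by rewrite ltn_eqF // (leq_trans (ltn_ord i)) ?leq_addl.
have [k Xk0] := nilM (ltn0Sn n) X; exists (n.+1 * k.+1)%N.
by rewrite exprM -XE -map_unitz_inX Xk0 map_mx0.
Qed.

Let c k := (companion ^+ k) 0 0.

(** The subdiagonal ones move the entries of the first column down by one
    row at each step. *)
Lemma companion_expE k j :
  (companion ^+ k) j 0 = if (j <= k)%N then c (k - j)%N else 0.
Proof.
elim: k j => [|k IHk] j.
  rewrite expr0 leqn0 /c sub0n expr0 !mxE eqxx -val_eqE /=.
  by case: eqP.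
case: (unliftP ord0 j) => [i|] ->; last by rewrite subn0.
rewrite exprS mxE (bigD1 (widen_ord (leqnSn n) i)) //= big1 => [|l li'].
  by rewrite mxE /= eqxx mul1r addr0 IHk.
rewrite mxE /= [_ == _](_ : _ = false) ?mul0r //.
by apply: contraNF li' => /eqP[li']; apply/eqP/val_inj.
Qed.

Lemma companion_rec k :
  c k.+1 = \sum_(i < k.+1) unitz_in p@_i.+1 * c (k - i)%N.
Proof.
rewrite /c exprS mxE -/c.
pose a i := if (i <= k)%N then unitz_in p@_i.+1 * c (k - i)%N else 0.
transitivity (\sum_(i < n.+1) a i).
  apply: eq_bigr => i _; rewrite mxE companion_expE /a.
  by case: ifP; rewrite ?mulr0.
pose N := (n + k).+1.
rewrite (big_ord_widen N a) ?ltnS ?leq_addr // big_mkcond /=.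
rewrite (big_ord_widen N (fun i => unitz_in p@_i.+1 * c (k - i)%N));
  last by rewrite ltnS leq_addl.
rewrite [RHS]big_mkcond /=; apply: eq_bigr => i _; rewrite /a !ltnS.
have [le_in|lt_ni] := leqP i n; case: ifP => // _.
by rewrite nupoly_boundP ?raddf0 ?mul0r // ltnW // ltnW.
Qed.

(** The generating polynomial of the upper left entries of the powers of the
    companion matrix is the inverse of 1 - p. *)
Lemma companion_right_quasi_regular : exists q, circ p q = 0.
Proof.
have [K CK0] := companion_nilpotent.
pose v : {poly U} := \poly_(i < K) c i.
have vE i : v`_i = c i.
  rewrite coef_poly; case: ltnP => // le_Ki.
  by rewrite /c -(subnK le_Ki) exprD CK0 mulr0 mxE.
apply: (@unitz_poly_right_inverse _ _ p v).
apply/polyP => k; rewrite mulrBl mul1r coefB coefM vE coef1 big_ord_recl.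
rewrite coef_unitz_poly p0 raddf0 mul0r add0r.
case: k => [|k]; first by rewrite big_ord0 subr0 /c expr0 mxE eqxx.
rewrite companion_rec; apply/eqP; rewrite subr_eq0; apply/eqP/eq_bigr => i _.
by rewrite coef_unitz_poly vE.
Qed.

End Companion.

(** The quasi-inverse of b is the finite sum - (b + b^2 + ...). *)
Lemma nil_quasi_regular (B : nuRingType) (b : B) :
  nil_nuring B -> quasi_regular B b.
Proof.
move=> nilB; move: b; apply: right_circ_quasi_regular => b.
have [n bn0] := nilB b; pose s m := \sum_(i < m) nuexpS b i.
exists (- s n); rewrite /circ numulN opprK addrAC.
have -> : b + b ** s n = s n.+1.
  by rewrite /s big_ord_recl nusumr.
by rewrite /s big_ord_recr /= bn0 addr0 subrr.
Qed.

Section NilMatricesRadical.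
Variables (F : fieldType) (A : nuAlgType F).
Hypothesis nilA : nil_nuring A.
Hypothesis nilM : forall n, (1 <= n)%N -> nil_nuring 'M[A]_n.

(** Composing with the quasi-inverse of the constant coefficient reduces to
    polynomials without constant coefficient. *)
Lemma nil_matrices_poly_radical : nujacobson (nupoly A) = setT.
Proof.
apply/nujacobsonTP/right_circ_quasi_regular => p.
have [b [ab0 ba0]] := nil_quasi_regular p@_0%N nilA.
have [|q pq0] := @companion_right_quasi_regular _ _ nilM (circ (nupolyC b) p).
  rewrite mcoeffB mcoeffD coef_nupolyM big_ord1 !coef_nupolyC /=.
  exact: ba0.
have C0 : nupolyC 0 = 0 :> nupoly A.
  by apply/malgP => i; rewrite coef_nupolyC mcoeff0 if_same.
exists (circ q (nupolyC b)); rewrite circA.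
have -> : circ p q = nupolyC p@_0%N.
  rewrite -[RHS]circa0 -pq0 -circA [in RHS]circA circ_nupolyC ab0 C0.
  by rewrite circ0a.
by rewrite circ_nupolyC ab0 C0.
Qed.

End NilMatricesRadical.

(** * Polynomials over a UJ-ring *)

Section PolyUnits.
Variables (R : nzRingType) (I : set R).
Hypotheses (gI : additive_subgroup I) (lI : forall a x, I x -> I (a * x))
  (rI : forall a x, I x -> I (x * a)) (sqrI : forall x, I (x * x) -> I x).

(** In a reduced ring, ab = 0 implies ba = 0 and a r b = 0; this is the case
    of the ring R/I. *)
Lemma reduced_insert a b r : I (a * b) -> I (a * r * b).
Proof.
move=> Iab; have Iba : I (b * a).
  by apply: sqrI; rewrite mulrA -(mulrA b) ; apply/rI/lI.
apply: sqrI; rewrite -!mulrA (mulrA b a); apply/lI/lI.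
by rewrite -mulrA mulrA; apply/rI.
Qed.

(** In the reduced ring R/I, if u_m is the leading coefficient of u and if
    m > 0, then u_m v_j = 0 for all j, by descending induction on j: multiply
    the vanishing coefficient of x^(m + j) in u v by u_m on the left. Then
    u_m = u_m v_0 u_0 is 0. *)
Lemma poly_unit_coef (u v : {poly R}) :
  u * v = 1 -> v * u = 1 -> forall m, (0 < m)%N -> I u`_m.
Proof.
move=> uv1 vu1.
suff uI k m : (0 < m)%N -> (size u <= m + k)%N -> I u`_m.
  by move=> m m0; apply: (uI (size u)); rewrite ?leq_addl.
elim: k m => [|k IHk] m m0 le_um.
  by rewrite addn0 in le_um; rewrite nth_default //; exact: subgroup0.
have high i : (m < i)%N -> I u`_i.
  move=> lt_mi; apply: IHk; first exact: leq_trans lt_mi.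
  by rewrite (leq_trans le_um) // addnS -addSn leq_add2r.
suff umv l j : (size v <= j + l)%N -> I (u`_m * v`_j).
  have v0u0 : v`_0 * u`_0 = 1 by rewrite -coef0M vu1 coef1.
  rewrite -[u`_m]mulr1 -v0u0 mulrA; apply: rI.
  by apply: (umv (size v)); rewrite leq_addl.
elim: l j => [|l IHl] j le_vj.
  rewrite addn0 in le_vj; rewrite [v`_j]nth_default // mulr0.
  exact: subgroup0.
have vhigh i : (j < i)%N -> I (u`_m * v`_i).
  move=> lt_ji; apply: IHl.
  by rewrite (leq_trans le_vj) // addnS -addSn leq_add2r.
suff /(reduced_insert v`_j) Iuuv : I (u`_m * (u`_m * v`_j)) by apply: sqrI.
have lt_m : (m < (m + j).+1)%N by rewrite ltnS leq_addr.
have := congr1 (fun f : {poly R} => f`_(m + j)) uv1.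
rewrite coefM (bigD1 (Ordinal lt_m)) //= addKn coef1 addn_eq0 gtn_eqF //=.
move/eqP; rewrite addr_eq0 => /eqP->; rewrite mulrN.
apply: (subgroupN gI); rewrite mulr_sumr; apply: (subgroup_sum gI) => i im.
have [lt_im|lt_mi|eq_im] := ltngtP i m.
- rewrite mulrA; apply/reduced_insert/vhigh.
  by rewrite ltn_subRL ltn_add2r.
- by apply/lI/rI/high.
- by case/eqP: im; apply: val_inj.
Qed.

End PolyUnits.

Section PolynomialUJ.
Hypothesis radical : forall A : nuAlgType 'F_2,
  nil_nuring A -> nujacobson (nupoly A) = setT.
Variable R : nzRingType.
Hypotheses (UJ : UJ_ring R) (nJ : jacobson R `<=` nilpotent R).
Implicit Types f g : {poly R}.

Let J := jacobson R.
Let gJ : additive_subgroup J := @jacobson_subgroup R.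

Lemma nilpotent_double f : nilpotent _ (f + f).
Proof.
have [m m0] := UJ_nilpotent2 UJ nJ; exists m.
rewrite -mulr2n exprMn_n -mulr_natr natrX -(rmorph_nat (polyC : R -> {poly R})).
by rewrite -rmorphXn /= m0 polyC0 mulr0.
Qed.

(** The polynomial [f] has a quasi-inverse modulo 2J[x], because J/2J is a
    nil algebra over the two-element field. A lift [g] of it gives
    (1 - g)(1 - f) = 1 - e with [e] in 2J[x], and [e] is nilpotent. *)
Lemma jacobson_coef_left_inverse f :
  (forall i, J f`_i) -> exists g, g * (1 - f) = 1.
Proof.
move=> Jf; pose J2 : set R := [set x | exists2 y, J y & x = y + y].
have gJ2 : additive_subgroup J2.
  split=> [|_ _ [y Jy ->] [z Jz ->]].
    by exists 0; rewrite ?addr0 //; exact: subgroup0.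
  by exists (y - z); [exact: (subgroupB gJ)|rewrite opprD addrACA].
have [|||x Jx|B [h hP]] := subquotient_exists (S := J) (@mulrA R)
  (@mulrDl R) (@mulrDr R) gJ _ gJ2.
- by move=> x y _ Jy; exact: (jacobsonMl x Jy).
- move=> s _ _ [y Jy ->]; exists (s * y); last exact: mulrDr.
  exact: (jacobsonMl s Jy).
- move=> s _ _ [y Jy ->]; exists (y * s); last exact: mulrDl.
  exact: (jacobsonMr s Jy).
- by exists x.
have h0 : h 0 = 0 := subquotient0 gJ hP.
have nilB : nil_nuring B.
  move=> b; have [x Jx <-] := subquotient_surj hP b.
  have hX n : J (x ^+ n.+1) /\ h (x ^+ n.+1) = nuexpS (h x) n.
    elim: n => [|n [JX hX]]; first by rewrite expr1.
    rewrite exprS; split; first exact: jacobsonMl.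
    by rewrite (subquotientM hP) // hX.
  have [n xn0] := nJ Jx; exists n.
  by rewrite -(hX n).2 exprS xn0 mulr0.
pose fB := nupoly_of (size f) (fun i => h f`_i).
have fBE i : fB@_i = h f`_i.
  rewrite coef_nupoly_of; case: ltnP => // le_fi.
  by rewrite nth_default.
have /nujacobsonTP/(_ fB)[gB [_ gfB0]] := radical nilB.
have /choice[l lP] : forall b, exists x, J x /\ h x = b.
  by move=> b; have [x] := subquotient_surj hP b; exists x.
pose g : {poly R} := \poly_(i < nupoly_bound gB) l gB@_i.
have gP i : J g`_i /\ h g`_i = gB@_i.
  rewrite coef_poly; case: ltnP => [_|/nupoly_boundP->]; first exact: lP.
  by split; rewrite ?h0 //; exact: subgroup0.
pose e := g + f - g * f.
have /choice[y yP] : forall i, exists y, e`_i = y + y.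
  move=> i; have Jgf (j : 'I_i.+1) : J (g`_j * f`_(i - j)).
    exact: (jacobsonMl _ (Jf _)).
  have Jgfs : J (g * f)`_i by rewrite coefM; apply: (subgroup_sum gJ).
  have Jgfi : J (g`_i + f`_i) by apply: (subgroupD gJ) => //; case: (gP i).
  suff [z _ ->] : J2 e`_i by exists z.
  rewrite coefB coefD; apply/(subquotient_eq0 hP); first exact: (subgroupB gJ).
  have [Jgi gE] := gP i.
  rewrite (subquotientB hP) // (subquotientD gJ hP) // gE -fBE.
  rewrite coefM (subquotient_sum gJ hP) //.
  have := congr1 (mcoeff i) gfB0; rewrite mcoeffB mcoeffD coef_nupolyM mcoeff0.
  apply: etrans; congr (_ - _); apply: eq_bigr => j _.
  by have [Jg <-] := gP j; rewrite fBE; apply: (subquotientM hP).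
pose d : {poly R} := \poly_(i < size e) y i.
have eE : e = d + d.
  apply/polyP => i; rewrite coefD coef_poly; case: ltnP => [_|le_ei].
    exact: yP.
  by rewrite nth_default ?addr0.
have [w [_ w1]] : units _ (1 - e).
  by apply: nilpotent_unit1B; rewrite eE; exact: nilpotent_double.
exists (w * (1 - g)); rewrite -mulrA -[RHS]w1; congr (w * _).
rewrite mulrBl mul1r mulrBr mulr1 opprB -addrA; congr (_ + _).
by rewrite [RHS]opprB opprD [RHS]addrA [RHS]addrC.
Qed.

Lemma jacobson_coef f : (forall i, J f`_i) -> jacobson _ f.
Proof.
apply: (@left_quasi_regular_jacobson _ [set f : {poly R} | forall i, J f`_i]).
  split; first split=> [i|p q Jp Jq i].
  - by rewrite coef0; exact: (subgroup0 gJ).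
  - by rewrite coefB; apply: (subgroupB gJ).
  - move=> p q Jq i; rewrite coefM; apply: (subgroup_sum gJ) => j _.
    exact: (jacobsonMl _ (Jq _)).
exact: jacobson_coef_left_inverse.
Qed.

Lemma polynomial_UJ : UJ_ring {poly R}.
Proof.
apply/UJ_ringP => u [v [uv1 vu1]]; apply: jacobson_coef => -[|i].
  rewrite coefB coef1; move/UJ_ringP : UJ; apply.
  by exists v`_0; rewrite -!coef0M uv1 vu1 coef1.
rewrite coefB coef1 subr0; apply: (poly_unit_coef _ _ _ _ uv1 vu1) => //.
- by move=> a x; apply: jacobsonMl.
- by move=> a x; apply: jacobsonMr.
- by move=> x; apply: UJ_jacobson_sqr.
Qed.

End PolynomialUJ.

(** * The equivalence *)

Theorem theorem2p6 :
  [<-> forall R : nzRingType,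
         UJ_ring R -> jacobson R `<=` nilpotent R -> UJ_ring {poly R};
       forall A : nuAlgType 'F_2,
         nil_nuring A -> nujacobson (nupoly A) = setT;
       forall A : nuAlgType 'F_2,
         nil_nuring A -> forall n, (1 <= n)%N -> nil_nuring 'M[A]_n;
       forall A : nuAlgType 'F_2, kothe_property A].
Proof.
tfae.
- move=> UJpoly A nilA; apply: UJ_poly_radical => //.
  by apply: UJpoly; [exact: unitization_UJ|exact: unitization_jacobson_nil].
- move=> radical A nilA n _ M; apply: quasi_regular_poly_nilpotent.
  by apply/nujacobsonTP/radical.
- by move=> nilM A; apply: nil_matrices_kothe.
- move=> kothe; apply: polynomial_UJ => A nilA.
  apply: nil_matrices_poly_radical => // n n_gt0.
  exact: kothe_nil_matrices.
Qed.
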